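(* Let $w=(w_i)_{i=1}^\infty\in(0,\infty)^{\mathbb N}$ be a weight and let $\mathcal B$ be a basis in a Banach space $\mathbb X$ over $\mathbb F\in\{\mathbb R,\mathbb C\}$. a) If $\mathcal B$ is $C_a$-$w$-almost-greedy, then $\mathcal B$ is $C_q$-quasi-greedy, $C_{sd}$-$w$-disjoint-super-democratic and $C_s$-$w$-super-democratic, with $$\max\{C_q,C_{sd}\}\le C_a,\qquad C_s\le 2\kappa C_a,$$ where $\kappa=1$ if $\mathbb F=\mathbb R$ and $\kappa=2$ if $\mathbb F=\mathbb C$. b) If $\mathcal B$ is $C_q$-quasi-greedy and $C_{sd}$-$w$-disjoint-super-democratic, then $\mathcal B$ is $C_a$-$w$-almost-greedy with $$C_a\le C_q+2C_qC_{sd}.$$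
   Context: Basis: a sequence $\mathcal B=(e_n)_{n\ge1}$ in $\mathbb X$ with biorthogonal functionals $(e_n^* )_{n\ge1}\subset\mathbb X^*$ which is a semi-normalized strong Markushevich basis, i.e. (a) $0<c_1:=\inf_n\{\|e_n\|,\|e_n^*\|\}\le\sup_n\{\|e_n\|,\|e_n^*\|\}=:c_2<\infty$; (b) $e_j^*(e_i)=\delta_{j,i}$; (c) $\mathbb X=\overline{\mathrm{span}}\{e_i:i\in\mathbb N\}$; (d) if $e_j^*(x)=0$ for all $j$ then $x=0$; (e) for every $A\subset\mathbb N$, $\overline{\mathrm{span}}\{e_i:i\in A\}=\{x\in\mathbb X: e_j^*(x)=0\ \forall j\notin A\}$. For finite $A\subset\mathbb N$: $P_A(x)=\sum_{n\in A}e_n^*(x)e_n$. A sign is a sequence $\varepsilon=(\varepsilon_n)$ of scalars in $\mathbb F$ with $|\varepsilon_n|=1$; $\mathbf 1_{\varepsilon A}=\sum_{n\in A}\varepsilon_ne_n$. $\mathbb N^{<\infty}$ is the set of finite subsets of $\mathbb N$, and $w(A)=\sum_{i\in A}w_i$. Greedy sums: for $x\in\mathbb X$, the natural greedy ordering lists indices so that $|e_n^*(x)|$ is non-increasing, with ties broken by putting the smaller index first; $A_m(x)$ is the set of the first $m$ indices, and $\mathcal G_m(x)=P_{A_m(x)}(x)$. $\mathcal B$ is quasi-greedy if there is $C>0$ with $\|x-\mathcal G_m(x)\|\le C\|x\|$ for all $x\in\mathbb X$, $m\in\mathbb N$; the least such $C$ is denoted $C_q$ (''$C_q$-quasi-greedy'').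 $\mathcal B$ is $w$-almost-greedy if there is $C>0$ with $\|x-\mathcal G_m(x)\|\le C\,\tilde\sigma^w_{w(A_m(x))}(x)$ for all $x\in\mathbb X$, $m\in\mathbb N$, where $\tilde\sigma^w_\delta(x)=\inf\{\|x-P_A(x)\|: A\in\mathbb N^{<\infty},\ w(A)\le\delta\}$; the least such $C$ is denoted $C_a$. $\mathcal B$ is $w$-super-democratic if there is $C>0$ with $\|\mathbf 1_{\varepsilon A}\|\le C\|\mathbf 1_{\varepsilon'B}\|$ for all $A,B\in\mathbb N^{<\infty}$ with $w(A)\le w(B)$ and all signs $\varepsilon,\varepsilon'$; the least such $C$ is denoted $C_s$. If the inequality is required only for such $A,B$ with $A\cap B=\emptyset$, $\mathcal B$ is $w$-disjoint-super-democratic, and the least constant is denoted $C_{sd}$. *)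

(* Defs.v *)
From HB Require Import structures.
From mathcomp Require Import all_boot all_order all_algebra.
From mathcomp Require Import finmap complex.
From mathcomp Require Import all_classical all_reals all_analysis.

Set Implicit Arguments.
Unset Strict Implicit.
Unset Printing Implicit Defensive.

Import Order.TTheory GRing.Theory Num.Theory.
Import numFieldNormedType.Exports.

Local Open Scope classical_set_scope.
Local Open Scope ring_scope.

Variant scalars := RealScalars | ComplexScalars.

Definition scalar_field (R : realType) (s : scalars) : numFieldType :=
  match s with
  | RealScalars => R
  | ComplexScalars => R[i]
  end.

(* In a normed module over K, norms are elements of K. Over R[i] they are
   nonnegative reals embedded in R[i]; [to_real] brings them back to R, where
   infima, suprema and weights live. It is only applied to norms. *)
Definition to_real (R : realType) (s : scalars) : scalar_field R s -> R :=
  match s with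
  | RealScalars => fun z => z
  | ComplexScalars => fun z => complex.Re z
  end.

Definition kappa (R : realType) (s : scalars) : R :=
  match s with
  | RealScalars => 1
  | ComplexScalars => 2
  end.

Definition least_element (R : realType) (S : set R) (c : R) : Prop :=
  S c /\ lbound S c.

Section Bases.
Context {R : realType} {s : scalars}.
Local Notation K := (scalar_field R s).
Context {X : completeNormedModType K}.

Definition rnorm (V : normedModType K) (v : V) : R := to_real `|v|.

Definition dual_norm (f : {scalar X}) : R :=
  sup [set to_real `|f x| | x in [set x : X | rnorm x <= 1]].

Definition lin_span (S : set X) : set X :=
  [set x | exists n (c : 'I_n -> K) (v : 'I_n -> X),
    (forall i, S (v i)) /\ x = \sum_(i < n) c i *: v i].

(* Sequences are indexed from 0: [e n] and [f n] stand for the (n+1)-st basis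
   vector and its biorthogonal functional. *)
Record is_basis (e : nat -> X) (f : nat -> {scalar X}) : Prop := IsBasis {
  basis_dual : forall n, continuous (f n);
  basis_inf_gt0 :
    0 < inf (range (fun n => rnorm (e n)) `|` range (fun n => dual_norm (f n)));
  basis_sup_fin :
    has_ubound
      (range (fun n => rnorm (e n)) `|` range (fun n => dual_norm (f n)));
  basis_biorthogonal : forall i j, f j (e i) = (j == i)%:R;
  basis_fundamental : closure (lin_span (range e)) = [set: X];
  basis_total : forall x, (forall j, f j x = 0) -> x = 0;
  basis_strong : forall A : set nat,
    closure (lin_span (e @` A)) = [set x | forall j, ~ A j -> f j x = 0]
}.

Definition is_sign (eps : nat -> K) : Prop := forall n, `|eps n| = 1.

Definition indicator_sum (e : nat -> X) (eps : nat -> K) (A : {fset nat}) : X :=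
  \sum_(n <- A) eps n *: e n.

Definition weight (w : nat -> R) (A : {fset nat}) : R := \sum_(i <- A) w i.

Section FixedBasis.
Variables (e : nat -> X) (f : nat -> {scalar X}).

Definition coord_proj (A : {fset nat}) (x : X) : X :=
  \sum_(n <- A) f n x *: e n.

(* The index listed right after those of A in the natural greedy ordering: the
   smallest index maximizing |f n x| outside A. The maximum is attained because
   the coefficients of x with respect to a basis tend to 0. *)
Definition greedy_next (x : X) (A : {fset nat}) : nat :=
  get [set n : nat | (n \notin A)%fset /\
    forall k : nat, (k \notin A)%fset ->
      `|f k x| < `|f n x| \/ (`|f k x| = `|f n x| /\ (n <= k)%N)].

Fixpoint greedy_set (x : X) (m : nat) : {fset nat} :=
  match m with
  | 0 => fset0
  | m'.+1 => (greedy_next x (greedy_set x m') |` greedy_set x m')%fset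
  end.

Definition greedy_sum (m : nat) (x : X) : X := coord_proj (greedy_set x m) x.

Definition best_weighted_error (w : nat -> R) (delta : R) (x : X) : R :=
  inf [set rnorm (x - coord_proj A x) | A in [set A | weight w A <= delta]].

Definition quasi_greedy_constants : set R :=
  [set C | 0 < C /\ forall (x : X) (m : nat), (0 < m)%N ->
    rnorm (x - greedy_sum m x) <= C * rnorm x].

Definition almost_greedy_constants (w : nat -> R) : set R :=
  [set C | 0 < C /\ forall (x : X) (m : nat), (0 < m)%N ->
    rnorm (x - greedy_sum m x) <=
      C * best_weighted_error w (weight w (greedy_set x m)) x].

End FixedBasis.

Definition super_democratic_constants (e : nat -> X) (w : nat -> R) : set R :=
  [set C | 0 < C /\ forall (A B : {fset nat}) (eps eps' : nat -> K),
    weight w A <= weight w B -> is_sign eps -> is_sign eps' ->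
    rnorm (indicator_sum e eps A) <= C * rnorm (indicator_sum e eps' B)].

Definition disjoint_super_democratic_constants
    (e : nat -> X) (w : nat -> R) : set R :=
  [set C | 0 < C /\ forall (A B : {fset nat}) (eps eps' : nat -> K),
    weight w A <= weight w B -> [disjoint A & B]%fset ->
    is_sign eps -> is_sign eps' ->
    rnorm (indicator_sum e eps A) <= C * rnorm (indicator_sum e eps' B)].

End Bases.

(* Main.v *)
(* Enlarging slightly the coefficients of y on D removes ties, so the greedy
   inequalities hold for y - P_D y whenever D is weakly greedy, that is
   |f_k y| <= |f_n y| for n in D and k outside D. The set D may
   be empty because a quasi-greedy constant C is at least 1: removing one index
   from a sum of n basis vectors gives u_(n-1) <= C u_n for their norms u_n, and
   C < 1 would bound them and then force sup u <= C sup u, hence u = 0.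

   a) For D contained in B and G disjoint from B with w(G) <= w(B \ D), the
   greedy set B \ D of 1_(G u B), compared with the competitor G, gives
   |1_(G u D)| <= Ca |1_B|. With G = A \ B and D running over the two sign
   classes of A n B this is the real case; real coefficients in [-1, 1] are
   convex combinations of signs, and the complex case splits the quotient of the
   two signs into real and imaginary parts.

   b) With y = x - P_B x, the set A \ B is weakly greedy for y, and
   x - P_A x = (y - P_(A\B) y) + P_(B\A) x. If t is the least |f_n x| over A \ B,
   convexity and democracy bound the last term by t Csd |1_(A\B)| with the signs of
   y, and Abel summation bounds t |1_(A\B)| by 2 Cq |y|. *)
Require Import Defs.
From HB Require Import structures.
From mathcomp Require Import all_boot all_order all_algebra.
From mathcomp Require Import finmap complex ring lra.
From mathcomp Require Import all_classical all_reals all_analysis.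

Import Order.TTheory GRing.Theory Num.Theory.
Import numFieldNormedType.Exports.
Local Open Scope classical_set_scope.
Local Open Scope ring_scope.

(** * Real and complex scalars treated at once through real-valued moduli *)

Section Scalars.
Local Set Implicit Arguments.
Local Unset Strict Implicit.
Variables (R : realType) (s : scalars).
Local Notation K := (scalar_field R s).

(** Bundling the embedding as a ring morphism confines the case split on [s] to the lemmas up to
    [scalar_decomposition]. *)
Definition of_real : {rmorphism R -> K} :=
  match s return {rmorphism R -> scalar_field R s} with
  | RealScalars => idfun
  | ComplexScalars => real_complex R
  end.

Definition scalar_abs (z : K) : R := to_real `|z|.

Lemma ler_of_real (x y : R) : (of_real x <= of_real y) = (x <= y).
Proof. by rewrite /of_real; case: s => //=; rewrite lecE eqxx. Qed.

Lemma normr_of_real (x : R) : `|of_real x| = of_real `|x|.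
Proof.
by rewrite /of_real; case: s => //=; rewrite normc_def /= expr0n addr0 sqrtr_sqr.
Qed.

Lemma of_realK : cancel of_real (@to_real R s).
Proof. by rewrite /of_real; case: s. Qed.

Lemma to_realK (z : K) : 0 <= z -> of_real (to_real z) = z.
Proof.
rewrite /of_real; case: s z => //= z; rewrite lecE => /andP[/eqP/= z0 _].
by case: z z0 => a b /= ->.
Qed.

(* [kappa - 1] records whether the imaginary part is really needed, so that a
   triangle inequality over this decomposition costs a factor [kappa]. *)
Lemma scalar_decomposition : exists (j : K) (re im : K -> R),
  scalar_abs j = kappa R s - 1 /\
  forall z : K, z = of_real (re z) + j * of_real (im z) /\
    `|re z| <= scalar_abs z /\ `|im z| <= scalar_abs z.
Proof.
rewrite /scalar_abs /of_real; case: s => /=.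
  exists 0, idfun, (fun=> 0); split.
    exact: etrans (normr0 R) (esym (subrr 1)).
  by move=> z; rewrite mul0r addr0 normr0 normr_ge0.
exists 'i%C, (@complex.Re R), (@complex.Im R); split.
  apply: (etrans (congr1 (@complex.Re R) (normc_def 'i%C))).
  by rewrite /= expr0n expr1n add0r sqrtr1; ring.
move=> z; split; first exact: complexE.
have h (u : R) : u ^+ 2 <= complex.Re z ^+ 2 + complex.Im z ^+ 2 ->
    `|u| <= complex.Re (`|z| : R[i]).
  by move=> uz; rewrite normc_def /= -sqrtr_sqr ler_wsqrtr.
by split; apply: h; rewrite ?lerDl ?lerDr sqr_ge0.
Qed.

Lemma of_real_abs (z : K) : of_real (scalar_abs z) = `|z|.
Proof. by rewrite to_realK. Qed.

Lemma ltr_of_real (x y : R) : (of_real x < of_real y) = (x < y).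
Proof. by rewrite !lt_neqAle ler_of_real (inj_eq (can_inj of_realK)). Qed.

Lemma scalar_absE (x : R) (z : K) : `|z| = of_real x -> scalar_abs z = x.
Proof. by move=> zx; rewrite /scalar_abs zx of_realK. Qed.

Lemma scalar_abs_ge0 (z : K) : 0 <= scalar_abs z.
Proof. by rewrite -ler_of_real of_real_abs rmorph0 normr_ge0. Qed.

Lemma scalar_abs_eq0 (z : K) : (scalar_abs z == 0) = (z == 0).
Proof. by rewrite -(inj_eq (can_inj of_realK)) of_real_abs rmorph0 normr_eq0. Qed.

Lemma scalar_abs0 : scalar_abs 0 = 0.
Proof. by apply/eqP; rewrite scalar_abs_eq0. Qed.

Lemma scalar_absM (y z : K) : scalar_abs (y * z) = scalar_abs y * scalar_abs z.
Proof. by apply: scalar_absE; rewrite normrM rmorphM /= !of_real_abs. Qed.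

Lemma scalar_abs_real (x : R) : scalar_abs (of_real x) = `|x|.
Proof. exact/scalar_absE/normr_of_real. Qed.

Lemma scalar_abs1P (z : K) : `|z| = 1 <-> scalar_abs z = 1.
Proof.
split=> [z1|z1]; first by apply: scalar_absE; rewrite z1 rmorph1.
by rewrite -of_real_abs z1 rmorph1.
Qed.

Lemma scalar_abs_lt (y z : K) : (`|y| < `|z|) = (scalar_abs y < scalar_abs z).
Proof. by rewrite -!of_real_abs ltr_of_real. Qed.

(** The value 1 at zero keeps it unimodular everywhere, so that it always yields a sign. *)
Definition scalar_sign (z : K) : K := if z == 0 then 1 else z / `|z|.

Lemma scalar_sign_norm (z : K) : `|scalar_sign z| = 1.
Proof.
rewrite /scalar_sign; case: eqVneq => [_|z0]; first by rewrite normr1.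
by rewrite normrM normfV normr_id divff// normr_eq0.
Qed.

Lemma scalar_sign_abs (z : K) : of_real (scalar_abs z) * scalar_sign z = z.
Proof.
rewrite of_real_abs /scalar_sign; case: eqVneq => [->|z0].
  by rewrite normr0 mul0r.
by rewrite mulrCA divff ?mulr1// normr_eq0.
Qed.

Lemma scalar_sign_add (z : K) (d : R) : 0 <= d ->
  scalar_abs (z + of_real d * scalar_sign z) = scalar_abs z + d.
Proof.
move=> d0; rewrite -{1}[z]scalar_sign_abs -mulrDl scalar_absM -rmorphD.
have /scalar_abs1P -> := scalar_sign_norm z; rewrite mulr1 scalar_abs_real ger0_norm//.
by rewrite addr_ge0// scalar_abs_ge0.
Qed.

(** * Norm inequalities: convexity over signs and Abel summation *)

Section Norm.
Variable V : normedModType K.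

Lemma of_real_rnorm (v : V) : of_real (rnorm v) = `|v|.
Proof. by rewrite to_realK. Qed.

Lemma rnorm_ge0 (v : V) : 0 <= rnorm v.
Proof. by rewrite -ler_of_real of_real_rnorm rmorph0 normr_ge0. Qed.

Lemma rnorm_eq0 (v : V) : (rnorm v == 0) = (v == 0).
Proof. by rewrite -(inj_eq (can_inj of_realK)) of_real_rnorm rmorph0 normr_eq0. Qed.

Lemma rnorm0 : rnorm (0 : V) = 0.
Proof. by apply/eqP; rewrite rnorm_eq0. Qed.

Lemma rnormD (u v : V) : rnorm (u + v) <= rnorm u + rnorm v.
Proof. by rewrite -ler_of_real rmorphD /= !of_real_rnorm ler_normD. Qed.

Lemma rnormN (v : V) : rnorm (- v) = rnorm v.
Proof. by rewrite /rnorm normrN. Qed.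

Lemma rnormB (u v : V) : rnorm (u - v) <= rnorm u + rnorm v.
Proof. by rewrite -(rnormN v) rnormD. Qed.

Lemma rnormZ (c : K) (v : V) : rnorm (c *: v) = scalar_abs c * rnorm v.
Proof.
by apply: (can_inj of_realK); rewrite rmorphM /= of_real_abs !of_real_rnorm normrZ.
Qed.

Lemma rnormZr (c : R) (v : V) : rnorm (of_real c *: v) = `|c| * rnorm v.
Proof. by rewrite rnormZ scalar_abs_real. Qed.

Lemma rnorm_sum (I : Type) (r : seq I) (F : I -> V) :
  rnorm (\sum_(i <- r) F i) <= \sum_(i <- r) rnorm (F i).
Proof.
elim: r => [|i r IH]; first by rewrite !big_nil rnorm0.
by rewrite !big_cons (le_trans (rnormD _ _))// lerD2l.
Qed.

(** A number a in [-1, 1] is the average of 1 and -1 with weights (1 + a) / 2 and (1 - a) / 2. The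
    induction replaces one coefficient at a time; [y] absorbs the terms whose sign is already
    fixed. *)
Lemma rnorm_convex_signs (r : seq nat) (v : nat -> V) (y : V) (M : R) :
  uniq r ->
  (forall d : nat -> bool,
     rnorm (y + \sum_(n <- r) of_real ((-1) ^+ d n) *: v n) <= M) ->
  forall a : nat -> R, (forall n, n \in r -> `|a n| <= 1) ->
    rnorm (y + \sum_(n <- r) of_real (a n) *: v n) <= M.
Proof.
elim: r y => [|k r IH] y.
  by move=> _ /(_ xpred0) + a _; rewrite !big_nil.
case/andP=> kr ur hM a ha.
have side (b : bool) :
    rnorm (y + of_real ((-1) ^+ b) *: v k + \sum_(n <- r) of_real (a n) *: v n) <= M.
  apply: IH => // [d|n nr]; last by apply: ha; rewrite inE nr orbT.
  have := hM (fun n => if n == k then b else d n).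
  rewrite big_cons eqxx addrA; congr (rnorm (_ + _) <= _).
  apply: eq_big_seq => n nr; case: eqP => // nk.
  by move: kr; rewrite -nk nr.
have ak : `|a k| <= 1 by apply: ha; rewrite inE eqxx.
rewrite big_cons addrA; set S := \sum_(n <- r) _ in side *.
have -> : y + of_real (a k) *: v k + S =
    of_real ((1 + a k) / 2) *: (y + of_real ((-1) ^+ false) *: v k + S) +
    of_real ((1 - a k) / 2) *: (y + of_real ((-1) ^+ true) *: v k + S).
  have ak2 : a k = (1 + a k) / 2 - (1 - a k) / 2 by field.
  have h : of_real ((1 + a k) / 2) + of_real ((1 - a k) / 2) = 1 :> K.
    by rewrite -rmorphD -(rmorph1 of_real); congr (of_real _); field.
  rewrite [in LHS]ak2 expr0 expr1 rmorphN !rmorph1 scale1r scaleN1r rmorphB /=.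
  rewrite ![y + _ + S]addrAC; move: (y + S) => T.
  rewrite -[T in LHS]scale1r -h scalerBl scalerDl !scalerDr scalerN -!addrA.
  by congr (_ + _); rewrite addrCA.
move: ak; rewrite ler_norml => /andP[a1 a2].
apply: le_trans (rnormD _ _) _; rewrite !rnormZr !ger0_norm; [|lra..].
have := side false; have := side true; nra.
Qed.

(* Abel summation, phrased by induction on [r] with [b] the last coefficient
   already peeled off. *)
Lemma rnorm_abel (r : seq nat) (v : nat -> V) (c : nat -> R) (M b : R) :
  path <=%R b (map c r) -> (forall n, n \in r -> c n <= 1) -> b <= 1 ->
  (forall k, rnorm (\sum_(n <- drop k r) v n) <= M) ->
  rnorm (\sum_(n <- r) of_real (c n - b) *: v n) <= (1 - b) * M.
Proof.
elim: r b => [|k r IH] b /=.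
  move=> _ _ b1 /(_ 0) /(le_trans (rnorm_ge0 _)) M0.
  by rewrite big_nil rnorm0 mulr_ge0// subr_ge0.
case/andP=> bk pr c1 b1 hM.
have ck : c k <= 1 by apply: c1; rewrite inE eqxx.
have -> : \sum_(n <- k :: r) of_real (c n - b) *: v n =
    of_real (c k - b) *: (\sum_(n <- k :: r) v n) +
    \sum_(n <- r) of_real (c n - c k) *: v n.
  rewrite !big_cons scalerDr -addrA scaler_sumr -big_split /=; congr (_ + _).
  by apply: eq_bigr => n _; rewrite -scalerDl -rmorphD; congr (of_real _ *: _); ring.
apply: le_trans (rnormD _ _) _; rewrite rnormZr ger0_norm ?subr_ge0//.
have h1 := hM 0; rewrite drop0 in h1.
have h2 : rnorm (\sum_(n <- r) of_real (c n - c k) *: v n) <= (1 - c k) * M.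
  apply: IH => // [n nr|i]; first by apply: c1; rewrite inE nr orbT.
  exact: (hM i.+1).
nra.
Qed.

End Norm.
End Scalars.

(** The inequalities are not strict, so they pass to the infimum of [S]. As 0 < C is also demanded,
    one positive [a i] is needed to keep that infimum away from 0. *)
Lemma least_element_exists (R : realType) (I : Type) (P : I -> Prop)
    (a b : I -> R) (S : set R) :
  (forall C, S C <-> 0 < C /\ forall i, P i -> a i <= C * b i) ->
  (forall i, P i -> 0 <= b i) -> (exists i, P i /\ 0 < a i) ->
  S !=set0 -> exists c, least_element S c.
Proof.
move=> SE b0 [i0 [Pi0 ai0]] S0.
have lS : lbound S 0 by move=> C /SE[C0 _]; exact: ltW.
have hlS : has_inf S by split=> //; exists 0.
exists (inf S); split; last by move=> C SC; apply: (ge_inf (ex_intro _ _ lS)).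
have main i : P i -> a i <= inf S * b i.
  (* Where [b i] vanishes, any admissible constant already gives [a i <= 0]; elsewhere [a i / b i]
     is a lower bound of [S]. *)
  move=> Pi; have := b0 i Pi; rewrite le_eqVlt => /orP[/eqP bi|bi].
    have [C /SE[_ /(_ _ Pi)]] := S0; by rewrite -bi !mulr0.
  rewrite -ler_pdivrMr//; apply: lb_le_inf => // C /SE[_ /(_ _ Pi)].
  by rewrite ler_pdivrMr.
apply/SE; split=> //; have := main _ Pi0.
have : 0 <= inf S by exact: lb_le_inf.
rewrite le_eqVlt => /orP[/eqP <-|//].
by rewrite mul0r leNgt ai0.
Qed.

(** * Coefficients, the natural greedy ordering, and removal of ties *)

Section Basis.
Local Set Implicit Arguments.
Local Unset Strict Implicit.
Variables (R : realType) (s : scalars) (X : completeNormedModType (scalar_field R s)).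
Local Notation K := (scalar_field R s).
Variables (e : nat -> X) (f : nat -> {scalar X}).
Hypothesis hB : is_basis e f.

Lemma coef_ext (x y : X) : (forall k, f k x = f k y) -> x = y.
Proof.
move=> xy; apply/eqP; rewrite -subr_eq0; apply/eqP/(basis_total hB) => k.
by rewrite linearB /= xy subrr.
Qed.

Lemma coef_indicator_sum (c : nat -> K) (A : {fset nat}) (k : nat) :
  f k (indicator_sum e c A) = if k \in A then c k else 0.
Proof.
rewrite /indicator_sum linear_sum /=.
under eq_bigr do rewrite linearZ /= (basis_biorthogonal hB).
case: ifPn => kA.
  rewrite (bigD1_seq k) ?fset_uniq//= eqxx mulr1 big1 ?addr0// => n nk.
  by rewrite eq_sym (negbTE nk) mulr0.
rewrite big1_seq// => n /andP[_ nA]; case: eqP => [kn|_]; last by rewrite mulr0.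
by rewrite kn nA in kA.
Qed.

Lemma coef_coord_proj (A : {fset nat}) (x : X) (k : nat) :
  f k (coord_proj e f A x) = if k \in A then f k x else 0.
Proof. exact: coef_indicator_sum. Qed.

Lemma coef_bounded (n : nat) (x : X) :
  scalar_abs (f n x) <= dual_norm (f n) * rnorm x.
Proof.
(* The supremum in [dual_norm] bounds its set only once that set is known to be bounded, which
   continuity of [f n] provides. *)
have ub : has_ubound [set to_real `|f n x| | x in [set x : X | rnorm x <= 1]].
  have /linear_boundedP : bounded_near (f n : X -> K^o) (nbhs (0 : X)).
    exact/continuous_linear_bounded/(basis_dual hB).
  move=> /pinfty_ex_gt0 [M M0 hM]; exists (scalar_abs M) => _ /= [z z1 <-].
  rewrite -(ler_of_real s) !of_real_abs (le_trans (hM z))//.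
  rewrite -of_real_rnorm (ger0_norm (ltW M0)) ler_piMr// ?(ltW M0)//.
  by rewrite -(rmorph1 (of_real R s)) ler_of_real.
have [->|x0] := eqVneq x 0; first by rewrite linear0 rnorm0 mulr0 scalar_abs0.
have nx : 0 < rnorm x by rewrite lt_neqAle eq_sym rnorm_eq0 x0 rnorm_ge0.
rewrite -ler_pdivrMr//; apply: ub_le_sup => //=.
exists (of_real R s (rnorm x)^-1 *: x) => /=.
  by rewrite rnormZr ger0_norm ?invr_ge0 ?rnorm_ge0// mulVf// rnorm_eq0.
rewrite linearZ /= -/(scalar_abs _) scalar_absM scalar_abs_real.
by rewrite ger0_norm ?invr_ge0 ?rnorm_ge0// mulrC.
Qed.

Lemma basis_uniform_bound : exists2 c : R, 0 < c &
  (forall n x, scalar_abs (f n x) <= c * rnorm x) /\ forall n, rnorm (e n) <= c.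
Proof.
have [M hM] := basis_sup_fin hB.
exists (Num.max M 1); first by rewrite lt_max ltr01 orbT.
split=> n => [x|].
  apply: le_trans (coef_bounded n x) _; apply: ler_wpM2r; first exact: rnorm_ge0.
  by rewrite le_max hM//; right; exists n.
by rewrite le_max hM//; left; exists n.
Qed.

Lemma basis_vector_gt0 (n : nat) : 0 < rnorm (e n).
Proof.
rewrite lt_neqAle rnorm_ge0 andbT eq_sym rnorm_eq0; apply/eqP => en.
have := basis_biorthogonal hB n n; rewrite en linear0 eqxx => /esym/eqP.
by rewrite oner_eq0.
Qed.

(** Approximate [x] within d / c by a finite combination of basis vectors; past its last index,
    [f n] sees only the error. *)
Lemma coef_vanishing (x : X) (d : R) : 0 < d ->
  exists N, forall n, (N <= n)%N -> scalar_abs (f n x) < d.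
Proof.
move=> d0; have [c c0 [hc _]] := basis_uniform_bound.
have : closure (lin_span (range e)) x by rewrite (basis_fundamental hB).
have dc : 0 < of_real R s (d / c).
  by rewrite -(rmorph0 (of_real R s)) ltr_of_real divr_gt0.
move=> /(_ _ (nbhsx_ballx x _ dc)) [y [[m [a [v [hv ->]]]]]].
rewrite -ball_normE /= -of_real_rnorm ltr_of_real => xy.
have /choice[i hi] : forall j, exists i, e i = v j.
  by move=> j; have [i _ <-] := hv j; exists i.
exists (\max_(j < m) i j).+1 => n Nn.
have -> : f n x = f n (x - \sum_(j < m) a j *: v j).
  rewrite linearB linear_sum /= big1 ?subr0// => j _.
  rewrite linearZ /= -hi (basis_biorthogonal hB).
  case: eqP => [ni|_]; last by rewrite mulr0.
  by move: Nn; rewrite ni ltnNge leq_bigmax.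
by apply: le_lt_trans (hc _ _) _; rewrite mulrC -ltr_pdivlMr.
Qed.

(** Since [greedy_next] is a [get], a maximizer must be shown to exist; the smallest one then
    satisfies the tie rule. *)
Lemma greedy_nextP (x : X) (A : {fset nat}) :
  let n := greedy_next f x A in
  n \notin A /\ forall k : nat, k \notin A ->
    `|f k x| < `|f n x| \/ (`|f k x| = `|f n x| /\ (n <= k)%N).
Proof.
pose mu k := scalar_abs (f k x).
pose P (n : nat) := (n \notin A) && `[< forall k, k \notin A -> mu k <= mu n >].
have exP : exists n, P n.
  (* If some coefficient outside [A] is nonzero, all those from some N on are smaller, and a maximum
     over a finite range suffices. Otherwise every index outside [A] is a maximizer. *)
  have [[k0 [k0A mk0]]|no] := pselect (exists k, k \notin A /\ 0 < mu k).
    have [N hN] := coef_vanishing x mk0.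
    have k0N : (k0 < N)%N.
      by rewrite ltnNge; apply/negP => /hN; rewrite /mu ltxx.
    have := @arg_maxP _ _ 'I_N (Ordinal k0N) (fun i => val i \notin A) mu k0A.
    case: arg_maxP => // i iA hi _.
    exists (val i); rewrite /P iA; apply/asboolP => k kA.
    have [kN|Nk] := ltnP k N; first exact: (hi (Ordinal kN)).
    by apply: le_trans (ltW (hN _ Nk)) (hi (Ordinal k0N) k0A).
  exists (\max_(i <- A) i).+1; rewrite /P; apply/andP; split.
    by apply/negP => /(@leq_bigmax_seq _ _ xpredT id) /(_ isT); rewrite ltnn.
  apply/asboolP => k kA; rewrite leNgt; apply/negP => lt.
  by apply: no; exists k; split=> //; apply: le_lt_trans lt; exact: scalar_abs_ge0.
apply: (@getPex _ [set n : nat | n \notin A /\ forall k : nat, k \notin A ->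
  `|f k x| < `|f n x| \/ (`|f k x| = `|f n x| /\ (n <= k)%N)]).
have [n /andP[nA /asboolP hn] nmin] := ex_minnP exP.
exists n; split=> // k kA; rewrite scalar_abs_lt.
have := hn k kA; rewrite le_eqVlt => /orP[/eqP mkn|]; last by left.
right; split; first by rewrite -!of_real_abs; congr (of_real _ _ _).
apply: nmin; rewrite /P kA; apply/asboolP => j /hn.
by rewrite /mu in mkn *; rewrite mkn.
Qed.

(** Unlike in [greedy_set], ties may be resolved in any way. *)
Definition weakly_greedy (x : X) (D : {fset nat}) : Prop :=
  forall n k, n \in D -> k \notin D -> scalar_abs (f k x) <= scalar_abs (f n x).

Lemma greedy_set_weakly_greedy (x : X) (m : nat) :
  weakly_greedy x (greedy_set f x m).
Proof.
elim: m => [//|m IH] n k /=; rewrite !inE negb_or => /orP[/eqP->|nG] /andP[_ kG].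
  have [_ /(_ k kG)] := greedy_nextP x (greedy_set f x m).
  by rewrite scalar_abs_lt => -[/ltW//|[h _]]; rewrite /scalar_abs h.
exact: IH.
Qed.

Lemma card_greedy_set (x : X) (m : nat) : #|` greedy_set f x m| = m.
Proof.
elim: m => [|m IH]; first exact: cardfs0.
by rewrite /= cardfsU1 (greedy_nextP x (greedy_set f x m)).1 IH.
Qed.

(** While an index of [D] remains unlisted, it beats every index outside [D]; so the first steps
    stay inside [D], and cardinality gives equality. *)
Lemma greedy_set_strict (x : X) (D : {fset nat}) :
  (forall n k, n \in D -> k \notin D -> scalar_abs (f k x) < scalar_abs (f n x)) ->
  greedy_set f x #|` D| = D.
Proof.
move=> hD.
have sub m : (m <= #|` D|)%N -> (greedy_set f x m `<=` D)%fset.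
  elim: m => [|m IH] mD /=; first exact: fsub0set.
  have GD := IH (ltnW mD); rewrite fsubUset fsub1set GD andbT.
  have [nG hn] := greedy_nextP x (greedy_set f x m).
  apply/negPn/negP => nD.
  have /fsubsetPn[d dD dG] : ~~ (D `<=` greedy_set f x m)%fset.
    by apply: contraL mD => /fsubset_leq_card; rewrite card_greedy_set -leqNgt.
  have := hn d dG; rewrite scalar_abs_lt => -[|[+ _]].
    by apply/negP; rewrite -leNgt; exact/ltW/hD.
  by move=> dn; have := hD _ _ dD nD; rewrite /scalar_abs dn ltxx.
by apply/eqP; rewrite eqEfcard sub//= card_greedy_set.
Qed.

Lemma rnorm_indicator_sum_le (c : R) (a : nat -> K) (A : {fset nat}) :
  (forall n, rnorm (e n) <= c) -> (forall n, scalar_abs (a n) <= 1) ->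
  rnorm (indicator_sum e a A) <= #|` A|%:R * c.
Proof.
move=> hc ha; apply: le_trans (rnorm_sum _ _) _.
rewrite mulr_natl -[_ *+ _]addr0 -iter_addr -[#|` A|]count_predT -big_const_seq.
apply: ler_sum => n _; rewrite rnormZ -[leRHS]mul1r.
by apply: ler_pM; rewrite ?scalar_abs_ge0 ?rnorm_ge0.
Qed.

(* Enlarging slightly the coefficients in [D] breaks all ties in favour of [D]. *)
Lemma weakly_greedy_perturbation (y : X) (D : {fset nat}) (d : R) :
  weakly_greedy y D -> 0 < d ->
  exists y' : X, [/\ greedy_set f y' #|` D| = D,
    y' - coord_proj e f D y' = y - coord_proj e f D y &
    forall E : {fset nat},
      rnorm (y' - coord_proj e f E y') <= rnorm (y - coord_proj e f E y) + d].
Proof.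
move=> hD d0; have [c c0 [_ hc]] := basis_uniform_bound.
have D0 : 0 <= #|` D|%:R :> R by [].
(* Moving the coefficients on part of [D] by h costs at most h c times the size of [D], hence at
   most d; the summand 1 keeps the denominator positive. *)
pose h := d / (1 + #|` D|%:R * c).
have h0 : 0 < h by rewrite divr_gt0//; nra.
pose sg n := scalar_sign (f n y).
pose p A := of_real R s h *: indicator_sum e sg A.
have cp A k : f k (p A) = if k \in A then of_real R s h * sg k else 0.
  by rewrite /p linearZ /= coef_indicator_sum; case: ifP => _; rewrite ?mulr0.
exists (y + p D); split.
- apply: greedy_set_strict => n k nD kD.
  rewrite !linearD /= !cp nD (negbTE kD) addr0 scalar_sign_add ?(ltW h0)//.
  by apply: le_lt_trans (hD _ _ nD kD) _; rewrite ltrDl.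
- apply: coef_ext => k; rewrite !linearB /= !coef_coord_proj linearD /= cp.
  by case: ifP => _; rewrite ?subrr ?addr0.
move=> E.
have -> : y + p D - coord_proj e f E (y + p D) =
    y - coord_proj e f E y + p (D `\` E)%fset.
  apply: coef_ext => k; rewrite linearB linearD [RHS]linearD linearB /=.
  rewrite !coef_coord_proj !cp inE linearD /= cp.
  by case: (k \in E); case: (k \in D) => /=; rewrite ?subrr ?addr0 ?subr0.
apply: le_trans (rnormD _ _) _; rewrite lerD2l rnormZr ger0_norm ?(ltW h0)//.
have sg1 n : scalar_abs (sg n) <= 1.
  by have /scalar_abs1P -> := scalar_sign_norm (f n y).
have := rnorm_indicator_sum_le (D `\` E)%fset hc sg1.
have : #|` (D `\` E)%fset|%:R <= #|` D|%:R :> R.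
  by rewrite ler_nat fsubset_leq_card// fsubsetDl.
have -> : d = h * (1 + #|` D|%:R * c) by rewrite /h divfK// gt_eqF//; nra.
rewrite ler_pM2l//; nra.
Qed.

End Basis.

(** * Weights of finite sets *)

Section Weight.
Local Set Implicit Arguments.
Local Unset Strict Implicit.
Variables (R : realType) (w : nat -> R).
Hypothesis hw : forall i, 0 < w i.

Lemma weight0 : weight w fset0 = 0.
Proof. exact: big_seq_fset0. Qed.

Lemma weight_ge0 (A : {fset nat}) : 0 <= weight w A.
Proof. by apply: sumr_ge0 => i _; exact: ltW. Qed.

Lemma weight_le0 (A : {fset nat}) : weight w A <= 0 -> A = fset0.
Proof.
move=> A0; apply/eqP; apply/negPn/negP => /fset0Pn[k kA].
move: A0; rewrite /weight (bigD1_seq k) ?fset_uniq//= leNgt ltr_pwDl//.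
by apply: sumr_ge0 => i _; exact: ltW.
Qed.

Lemma weight_split (A B : {fset nat}) :
  weight w A = weight w (A `&` B)%fset + weight w (A `\` B)%fset.
Proof.
rewrite /weight (bigID (mem B)) /= -[X in X + _]big_filter -[X in _ + X]big_filter.
congr (_ + _); apply: perm_big; rewrite uniq_perm ?filter_uniq ?fset_uniq// => i.
  by rewrite mem_filter !inE andbC.
by rewrite mem_filter !inE.
Qed.

Lemma weight_sub (A B : {fset nat}) : (A `<=` B)%fset -> weight w A <= weight w B.
Proof.
by move=> /fsetIidPr AB; rewrite (weight_split B A) AB lerDl weight_ge0.
Qed.

Lemma weight_setD (A B : {fset nat}) : weight w A <= weight w B ->
  weight w (A `\` B)%fset <= weight w (B `\` A)%fset.
Proof. by rewrite (weight_split A B) (weight_split B A) fsetIC lerD2l. Qed.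
End Weight.

(** * Greedy inequalities for weakly greedy sets *)

Section Greedy.
Local Set Implicit Arguments.
Local Unset Strict Implicit.
Variables (R : realType) (s : scalars) (X : completeNormedModType (scalar_field R s)).
Local Notation K := (scalar_field R s).
Variables (e : nat -> X) (f : nat -> {scalar X}).
Hypothesis hB : is_basis e f.

Lemma coord_proj0 (x : X) : coord_proj e f fset0 x = 0.
Proof. exact: big_seq_fset0. Qed.

(** The constants control only m > 0, hence [D] nonempty. A perturbation of size d / C costs at most
    d, which is arbitrary. *)
Lemma quasi_greedy_nonempty (C : R) (y : X) (D : {fset nat}) :
  quasi_greedy_constants e f C -> weakly_greedy f y D -> D != fset0 ->
  rnorm (y - coord_proj e f D y) <= C * rnorm y.
Proof.
move=> [C0 hC] hD D0; apply/ler_addgt0Pr => d d0.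
have [y' [hG hy hE]] := weakly_greedy_perturbation hB hD (divr_gt0 d0 C0).
have := hC y' #|` D|; rewrite cardfs_gt0 /greedy_sum hG hy => /(_ D0) h.
apply: le_trans h _; have := hE fset0; rewrite !coord_proj0 !subr0 => h.
by rewrite mulrC -ler_pdivlMr// mulrDl [C * _]mulrC mulfK ?gt_eqF.
Qed.

Lemma quasi_greedy_ge1 (C : R) : quasi_greedy_constants e f C -> 1 <= C.
Proof.
move=> hC; have [C0 _] := hC; rewrite leNgt; apply/negP => C1.
have [c c0 [_ hc]] := basis_uniform_bound hB.
pose y L := indicator_sum e (fun=> 1) [fset i in iota 0 L]%fset.
have cy L k : f k (y L) = if (k < L)%N then 1 else 0.
  by rewrite (coef_indicator_sum hB) !inE mem_iota add0n.
have yS L : y L.+1 = y L + e L.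
  apply: (coef_ext hB) => k; rewrite linearD /= !cy (basis_biorthogonal hB) ltnS.
  by rewrite (leq_eqVlt k L); case: ltngtP; rewrite ?addr0 ?add0r.
(* All nonzero coefficients of [y L.+1] equal 1, so the single index [L] is weakly greedy for it. *)
have uC L : rnorm (y L) <= C * rnorm (y L.+1).
  have -> : y L = y L.+1 - coord_proj e f [fset L]%fset (y L.+1).
    apply: (coef_ext hB) => k; rewrite linearB /= (coef_coord_proj hB) !cy !inE ltnS.
    by rewrite (leq_eqVlt k L); case: ltngtP; rewrite ?subr0 ?subrr.
  apply: quasi_greedy_nonempty => //; last first.
    by apply/fset0Pn; exists L; rewrite inE.
  move=> n k; rewrite !inE => /eqP -> _; rewrite !cy ltnSn.
  have h1 : scalar_abs (1 : K) = 1 by apply/scalar_abs1P; rewrite normr1.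
  by case: ifP; rewrite ?scalar_abs0 h1.
have hs : has_sup (range (rnorm (V:=X) \o y)).
  split; first by exists (rnorm (y 0%N)), 0%N.
  (* With u_L the norm of [y L], solve u_L <= C u_(L+1) <= C (u_L + c) for u_L. *)
  exists (C * c / (1 - C)) => _ [L _ <-] /=.
  rewrite ler_pdivlMr ?subr_gt0//.
  have := uC L; rewrite yS; have := rnormD (y L) (e L); have := hc L; nra.
have leS L : rnorm (y L) <= sup (range (rnorm (V:=X) \o y)).
  by apply: ub_le_sup; [exact: hs.2 | exists L].
have : sup (range (rnorm (V:=X) \o y)) <= C * sup (range (rnorm (V:=X) \o y)).
  apply: ge_sup; first exact: hs.1.
  by move=> _ [L _ <-] /=; apply: le_trans (uC L) _; rewrite ler_pM2l.
have y1 : 0 < rnorm (y 1%N).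
  rewrite yS (_ : y 0%N = 0) ?add0r; first exact: (basis_vector_gt0 hB).
  by apply: (coef_ext hB) => k; rewrite cy linear0.
have := leS 1%N; nra.
Qed.

Lemma quasi_greedy_weakly (C : R) (y : X) (D : {fset nat}) :
  quasi_greedy_constants e f C -> weakly_greedy f y D ->
  rnorm (y - coord_proj e f D y) <= C * rnorm y.
Proof.
move=> hC hD; have [->|] := eqVneq D fset0; last exact: quasi_greedy_nonempty.
by rewrite coord_proj0 subr0 ler_peMl ?rnorm_ge0 ?quasi_greedy_ge1.
Qed.

Section Weighted.
Variable w : nat -> R.
Hypothesis hw : forall i, 0 < w i.

Lemma best_weighted_error_le (d : R) (x : X) (E : {fset nat}) :
  weight w E <= d ->
  best_weighted_error e f w d x <= rnorm (x - coord_proj e f E x).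
Proof.
move=> Ed; apply: ge_inf; last by exists E.
by exists 0 => _ [A _ <-]; exact: rnorm_ge0.
Qed.

(** For 0 <= d the empty set is a competitor, so the infimum is not the default value of an empty
    set. *)
Lemma best_weighted_error_ge (d : R) (x : X) (b : R) : 0 <= d ->
  (forall E, weight w E <= d -> b <= rnorm (x - coord_proj e f E x)) ->
  b <= best_weighted_error e f w d x.
Proof.
move=> d0 hb; apply: lb_le_inf => [|_ [E /hb Eb <-]//].
by exists (rnorm (x - coord_proj e f fset0 x)), fset0 => //=; rewrite weight0.
Qed.

Lemma almost_greedy_quasi_greedy (C : R) :
  almost_greedy_constants e f w C -> quasi_greedy_constants e f C.
Proof.
move=> [C0 hC]; split=> // x m m0; apply: le_trans (hC x m m0) _.
rewrite ler_pM2l// -[in leRHS](subr0 x) -(coord_proj0 x).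
by apply: best_weighted_error_le; rewrite weight0 weight_ge0.
Qed.

Lemma almost_greedy_weakly (C : R) (y : X) (D E : {fset nat}) :
  almost_greedy_constants e f w C -> weakly_greedy f y D ->
  weight w E <= weight w D ->
  rnorm (y - coord_proj e f D y) <= C * rnorm (y - coord_proj e f E y).
Proof.
move=> hC hD; have [->|D0] := eqVneq D fset0.
  (* Positive weights force [E] to be empty as well, and 1 <= C settles the case. *)
  rewrite weight0 => /(weight_le0 hw) ->.
  by rewrite ler_peMl ?rnorm_ge0 ?quasi_greedy_ge1//; exact: almost_greedy_quasi_greedy.
move=> ED; have [C0 {}hC] := hC; apply/ler_addgt0Pr => d d0.
have [y' [hG hy hE]] := weakly_greedy_perturbation hB hD (divr_gt0 d0 C0).
have := hC y' #|` D|; rewrite cardfs_gt0 /greedy_sum hG hy => /(_ D0) h.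
apply: le_trans h _; have := best_weighted_error_le y' ED.
move=> /le_trans /(_ (hE E)) h.
by rewrite mulrC -ler_pdivlMr// mulrDl [C * _]mulrC mulfK ?gt_eqF.
Qed.

End Weighted.
End Greedy.

(** * Democracy from almost-greediness, and the converse estimate *)

Section Estimates.
Local Set Implicit Arguments.
Local Unset Strict Implicit.
Variables (R : realType) (s : scalars) (X : completeNormedModType (scalar_field R s)).
Local Notation K := (scalar_field R s).
Variables (e : nat -> X) (f : nat -> {scalar X}) (w : nat -> R).
Hypotheses (hB : is_basis e f) (hw : forall i, 0 < w i).

Lemma indicator_sum0 (eps : nat -> K) : indicator_sum e eps fset0 = 0.
Proof. exact: big_seq_fset0. Qed.

Lemma eq_indicator_sum (c c' : nat -> K) (A : {fset nat}) :
  (forall n, n \in A -> c n = c' n) -> indicator_sum e c A = indicator_sum e c' A.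
Proof. by move=> cc'; apply: eq_big_seq => n /cc' ->. Qed.

(** All coefficients of [y] have modulus 0 or 1, so every subset of its support is weakly greedy.
    Removing B \ D leaves the left side, removing the competitor G leaves 1_B. *)
Lemma almost_greedy_indicator (C : R) (eps : nat -> K) (G B D : {fset nat}) :
  almost_greedy_constants e f w C -> is_sign eps -> [disjoint G & B]%fset ->
  (D `<=` B)%fset -> weight w G <= weight w (B `\` D)%fset ->
  rnorm (indicator_sum e eps (G `|` D)%fset) <= C * rnorm (indicator_sum e eps B).
Proof.
move=> hC heps /fdisjointP GB /fsubsetP DB GBD.
pose y := indicator_sum e eps (G `|` B)%fset.
have cy k : f k y = if (k \in G) || (k \in B) then eps k else 0.
  by rewrite (coef_indicator_sum hB) inE.
have -> : indicator_sum e eps (G `|` D)%fset = y - coord_proj e f (B `\` D)%fset y.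
  apply: (coef_ext hB) => k; rewrite linearB /= (coef_coord_proj hB) !cy.
  rewrite (coef_indicator_sum hB) !inE; have := GB k; have := DB k.
  case: (k \in G); case: (k \in D); case: (k \in B) => /= h1 h2;
    rewrite ?subrr ?subr0 //; first [by have := h1 isT | by have := h2 isT].
have -> : indicator_sum e eps B = y - coord_proj e f G y.
  apply: (coef_ext hB) => k; rewrite linearB /= (coef_coord_proj hB) !cy.
  rewrite (coef_indicator_sum hB); have := GB k.
  case: (k \in G); case: (k \in B) => /= h; rewrite ?subrr ?subr0 //.
  by have := h isT.
apply: almost_greedy_weakly GBD => // n k; rewrite inE => /andP[_ nB] _.
rewrite !cy nB orbT; have /scalar_abs1P -> := heps n.
by case: ifP => _; [have /scalar_abs1P -> := heps k | rewrite scalar_abs0].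
Qed.

Lemma almost_greedy_real_coefs (C : R) (eps : nat -> K) (G B D : {fset nat})
    (a : nat -> R) :
  almost_greedy_constants e f w C -> is_sign eps -> [disjoint G & B]%fset ->
  (D `<=` B)%fset -> weight w G <= weight w (B `\` D)%fset ->
  (forall n, n \in D -> `|a n| <= 1) ->
  rnorm (indicator_sum e eps G + \sum_(n <- D) of_real R s (a n) *: (eps n *: e n))
    <= 2 * C * rnorm (indicator_sum e eps B).
Proof.
move=> hC heps GB DB GBD; apply: rnorm_convex_signs => [|d]; first exact: fset_uniq.
(* For a fixed sign pattern the vector is 1_(G u Dp) - 1_Dm; each term is at most C |1_B|, whence
   the factor 2. *)
pose Dp := [fset n in D | ~~ d n]%fset; pose Dm := [fset n in D | d n]%fset.
have DpD : (Dp `<=` D)%fset by apply/fsubsetP => n; rewrite !inE => /andP[].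
have DmD : (Dm `<=` D)%fset by apply/fsubsetP => n; rewrite !inE => /andP[].
have -> : indicator_sum e eps G +
    \sum_(n <- D) of_real R s ((-1) ^+ d n) *: (eps n *: e n) =
    indicator_sum e eps (G `|` Dp)%fset - indicator_sum e eps (fset0 `|` Dm)%fset.
  have -> : \sum_(n <- D) of_real R s ((-1) ^+ d n) *: (eps n *: e n) =
      indicator_sum e (fun n => of_real R s ((-1) ^+ d n) * eps n) D.
    by apply: eq_bigr => n _; rewrite scalerA.
  apply: (coef_ext hB) => k; rewrite linearD linearB /= !(coef_indicator_sum hB).
  rewrite !inE; have := fdisjointP GB k; have := fsubsetP DB k.
  case: (k \in G); case: (k \in D); case: (d k) => /= h1 h2;
    rewrite ?expr1 ?expr0 ?rmorphN ?rmorph1 ?mulN1r ?mul1r;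
    rewrite ?addr0 ?add0r ?subr0 ?sub0r ?oppr0 //;
    by have := h2 isT; rewrite h1.
apply: le_trans (rnormB _ _) _; rewrite -mulrA mulr_natl mulr2n; apply: lerD.
  apply: almost_greedy_indicator => //; first exact: fsubset_trans DB.
  by apply: le_trans GBD _; apply: weight_sub => //; apply: fsetDS.
apply: almost_greedy_indicator => //; first exact: fdisjoint0X.
  exact: fsubset_trans DB.
by rewrite weight0 weight_ge0.
Qed.

(** Disjointness lets one sign sequence serve both sets; then [almost_greedy_indicator] applies with
    [D] empty, at no loss. *)
Lemma almost_greedy_disjoint_super_democratic (C : R) :
  almost_greedy_constants e f w C -> disjoint_super_democratic_constants e w C.
Proof.
move=> hC; split=> [|A B eps eps' AB disj heps heps']; first by case: hC.
pose c n := if n \in B then eps' n else eps n.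
have hc : is_sign c by move=> n; rewrite /c; case: ifP.
have -> : indicator_sum e eps A = indicator_sum e c (A `|` fset0)%fset.
  rewrite fsetU0; apply: eq_indicator_sum => n nA.
  by rewrite /c (negbTE (fdisjointP disj n nA)).
have -> : indicator_sum e eps' B = indicator_sum e c B.
  by apply: eq_indicator_sum => n nB; rewrite /c nB.
by apply: almost_greedy_indicator; rewrite ?fsub0set ?fsetD0.
Qed.

Lemma almost_greedy_super_democratic (C : R) :
  almost_greedy_constants e f w C ->
  super_democratic_constants e w (2 * kappa R s * C).
Proof.
move=> hC; have [C0 _] := hC; have [j [re [im [hj hreim]]]] := scalar_decomposition R s.
have k1 : 0 <= kappa R s - 1 by rewrite -hj scalar_abs_ge0.
split=> [|A B eps eps' AB heps heps']; first by apply: mulr_gt0 => //; lra.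
pose c n := if n \in B then eps' n else eps n.
have hc : is_sign c by move=> n; rewrite /c; case: ifP.
have -> : indicator_sum e eps' B = indicator_sum e c B.
  by apply: eq_indicator_sum => n nB; rewrite /c nB.
pose G := (A `\` B)%fset; pose D := (A `&` B)%fset.
(* The quotient differs from 1 at most on [B], so only the coefficients on [D] need splitting. *)
pose u n := eps n / c n.
have u1 n : scalar_abs (u n) = 1.
  by apply/scalar_abs1P; rewrite normrM normfV heps hc divr1.
have GB : [disjoint G & B]%fset.
  by apply/fdisjointP => n; rewrite inE => /andP[].
have DB : (D `<=` B)%fset by exact: fsubsetIr.
have GBD : weight w G <= weight w (B `\` D)%fset.
  by rewrite /D fsetDIr fsetDv fsetU0; exact: weight_setD.
have hre n : `|re (u n)| <= 1 by rewrite -(u1 n) (hreim (u n)).2.1.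
have him n : `|im (u n)| <= 1 by rewrite -(u1 n) (hreim (u n)).2.2.
(* The whole of 1_G goes into the real part. The two parts then cost 2 C and (kappa - 1) 2 C, in
   total 2 kappa C. *)
pose Re_part := indicator_sum e c G +
  \sum_(n <- D) of_real R s (re (u n)) *: (c n *: e n).
pose Im_part := indicator_sum e c fset0 +
  \sum_(n <- D) of_real R s (im (u n)) *: (c n *: e n).
have -> : indicator_sum e eps A = Re_part + j *: Im_part.
  rewrite /Re_part /Im_part indicator_sum0 add0r.
  have -> : \sum_(n <- D) of_real R s (re (u n)) *: (c n *: e n) =
      indicator_sum e (fun n => of_real R s (re (u n)) * c n) D.
    by apply: eq_bigr => n _; rewrite scalerA.
  have -> : \sum_(n <- D) of_real R s (im (u n)) *: (c n *: e n) =
      indicator_sum e (fun n => of_real R s (im (u n)) * c n) D.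
    by apply: eq_bigr => n _; rewrite scalerA.
  apply: (coef_ext hB) => k; rewrite !linearD linearZ /= !(coef_indicator_sum hB) !inE.
  have := (hreim (u k)).1.
  case: (k \in A) => /=; last by rewrite andbF mulr0 !addr0.
  have [kB|kB] /= := boolP (k \in B); last first.
    by rewrite mulr0 !addr0 /c (negbTE kB).
  move=> uk; rewrite add0r mulrA -mulrDl -uk /u divfK//.
  by rewrite -normr_eq0 hc oner_eq0.
have h1 : rnorm Re_part <= 2 * C * rnorm (indicator_sum e c B).
  exact: almost_greedy_real_coefs.
have h2 : rnorm Im_part <= 2 * C * rnorm (indicator_sum e c B).
  apply: almost_greedy_real_coefs => //; first exact: fdisjoint0X.
  by rewrite weight0 weight_ge0.
apply: le_trans (rnormD _ _) _; rewrite rnormZ hj.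
have := ler_wpM2l k1 h2; lra.
Qed.

(** Scaling f_n y by t / |f_n y| cuts its modulus down to t. Listed by decreasing modulus, these
    factors increase within (0, 1], so Abel summation reduces the claim to tails of the list. *)
Lemma quasi_greedy_truncation (C t : R) (y : X) (D : {fset nat}) :
  quasi_greedy_constants e f C -> weakly_greedy f y D -> 0 < t ->
  (forall n, n \in D -> t <= scalar_abs (f n y)) ->
  rnorm (of_real R s t *: indicator_sum e (fun n => scalar_sign (f n y)) D)
    <= 2 * C * rnorm y.
Proof.
move=> hC hD t0 ht.
pose mu n := scalar_abs (f n y).
pose r := [rel m n : nat | mu n <= mu m].
have rtot : total r by move=> m n; exact: le_total.
have rtr : transitive r by move=> m n k /= h1 h2; exact: le_trans h2 h1.
pose l := sort r D.
have lD : perm_eq l D by rewrite perm_sort.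
have lin n : (n \in l) = (n \in D) by rewrite mem_sort.
have lsort : sorted r l by exact: sort_sorted.
have lu : uniq l by rewrite sort_uniq fset_uniq.
have mu0 n : n \in D -> 0 < mu n by move=> /ht; exact: lt_le_trans.
pose c n := t / mu n.
have -> : of_real R s t *: indicator_sum e (fun n => scalar_sign (f n y)) D =
    \sum_(n <- l) of_real R s (c n - 0) *: (f n y *: e n).
  rewrite (perm_big _ lD) scaler_sumr; apply: eq_big_seq => n nD /=.
  rewrite !scalerA subr0; congr (_ *: _).
  rewrite -{2}(scalar_sign_abs (f n y)) mulrA -rmorphM /= /c divfK//.
  by rewrite gt_eqF// mu0.
rewrite -[leRHS]mul1r -[in leRHS](subr0 1); apply: rnorm_abel => //.
- rewrite path_sortedE; last exact: le_trans.
  apply/andP; split.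
    by apply/allP => _ /mapP[n nl ->]; rewrite divr_ge0 ?(ltW t0) ?scalar_abs_ge0.
  rewrite sorted_map; apply: (sub_in_sorted (P := mem D)) lsort; last first.
    by apply/allP => n; rewrite lin.
  move=> m n mD nD /= mn; rewrite ler_pM2l// lef_pV2// posrE ?mu0//.
- by move=> n; rewrite lin => nD; rewrite ler_pdivrMr ?mul1r ?ht ?mu0.
(* Both [T] and [D] are weakly greedy for [y], and the tail is the difference of their remainders;
   this gives 2 C. *)
move=> k; pose T := [fset n in take k l]%fset.
have hT : weakly_greedy f y T.
  move=> n i; rewrite !inE => nT iT.
  have nl : n \in l by exact: mem_take nT.
  have [iD|iD] := boolP (i \in D); last by apply: hD => //; rewrite -lin.
  have il : i \in drop k l.
    by move: iD; rewrite -lin -{1}(cat_take_drop k l) mem_cat (negbTE iT).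
  move: lsort; rewrite (sorted_pairwise rtr) -(cat_take_drop k l) pairwise_cat.
  by case/andP=> /allrelP /(_ _ _ nT il).
have -> : \sum_(n <- drop k l) f n y *: e n =
    (y - coord_proj e f T y) - (y - coord_proj e f D y).
  have -> : coord_proj e f D y =
      coord_proj e f T y + \sum_(n <- drop k l) f n y *: e n.
    rewrite /coord_proj -(perm_big _ lD) -{1}(cat_take_drop k l) big_cat /=.
    congr (_ + _); apply: perm_big.
    by apply: uniq_perm; rewrite ?fset_uniq ?take_uniq// => n; rewrite inE.
  by rewrite opprB [RHS]addrC addrA subrK addrC addKr.
have h1 := quasi_greedy_weakly hB hC hT; have h2 := quasi_greedy_weakly hB hC hD.
apply: le_trans (rnormB _ _) _; lra.
Qed.

Lemma quasi_greedy_democratic_almost_greedy (C Cd : R) (x : X) (A B : {fset nat}) :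
  quasi_greedy_constants e f C -> disjoint_super_democratic_constants e w Cd ->
  weakly_greedy f x A -> weight w B <= weight w A ->
  rnorm (x - coord_proj e f A x) <=
    (C + 2 * C * Cd) * rnorm (x - coord_proj e f B x).
Proof.
move=> hC [Cd0 hCd] hA BA.
pose y := x - coord_proj e f B x; pose D := (A `\` B)%fset; pose E := (B `\` A)%fset.
have C0 : 0 < C by case: hC.
have cy k : f k y = if k \in B then 0 else f k x.
  by rewrite /y linearB /= (coef_coord_proj hB); case: ifP; rewrite ?subrr ?subr0.
have hD : weakly_greedy f y D.
  move=> n k; rewrite !inE => /andP[nB nA] kD; rewrite !cy (negbTE nB).
  case: ifPn => kB; first by rewrite scalar_abs0 scalar_abs_ge0.
  by apply: hA => //; move: kD; rewrite kB.
have -> : x - coord_proj e f A x = (y - coord_proj e f D y) + coord_proj e f E x.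
  apply: (coef_ext hB) => k; rewrite [LHS]linearB [RHS]linearD linearB /=.
  rewrite !(coef_coord_proj hB) !cy !inE.
  by case: (k \in A); case: (k \in B); rewrite /= ?subrr ?subr0 ?addr0 ?add0r.
have h1 := quasi_greedy_weakly hB hC hD.
suff h2 : rnorm (coord_proj e f E x) <= Cd * (2 * C * rnorm y).
  by apply: le_trans (rnormD _ _) _; rewrite -/y; lra.
have ED : weight w E <= weight w D by exact: weight_setD.
have rhs0 : 0 <= Cd * (2 * C * rnorm y).
  by rewrite !mulr_ge0 ?rnorm_ge0 ?(ltW C0) ?(ltW Cd0).
(* With [D] empty there is no minimum to take, but then [E] has weight at most 0 and is empty
   too. *)
have [D0|/fset0Pn[n1 n1D]] := eqVneq D fset0.
  rewrite D0 weight0 in ED; rewrite (weight_le0 hw ED) coord_proj0 rnorm0//.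
pose mu n := scalar_abs (f n x).
have [n0 n0D hn0] : exists2 n0, n0 \in D & forall n, n \in D -> mu n0 <= mu n.
  have := @arg_minP _ _ D [` n1D]%fset xpredT (fun i => mu (val i)) isT.
  case: arg_minP => // i _ hi _; exists (val i) => [|n nD]; first exact: valP.
  exact: (hi [` nD]%fset).
have n0A : n0 \in A by move: n0D; rewrite inE => /andP[].
pose t := mu n0.
have htE n : n \in E -> mu n <= t.
  by rewrite inE => /andP[nA _]; exact: hA.
have : 0 <= t by exact: scalar_abs_ge0.
(* If t = 0, the coefficients of [x] on [E] vanish; otherwise division by t is allowed. *)
rewrite le_eqVlt => /orP[/eqP t0|t0].
  rewrite (_ : coord_proj e f E x = 0) ?rnorm0//.
  apply: (coef_ext hB) => k; rewrite (coef_coord_proj hB) linear0.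
  case: ifP => // /htE; rewrite -t0 => kE; apply/eqP; rewrite -scalar_abs_eq0.
  by rewrite eq_le kE scalar_abs_ge0.
pose v n := (of_real R s t * scalar_sign (f n x)) *: e n.
(* Each coefficient on [E] is t times its sign, scaled by a factor in [0, 1], as convexity over
   signs requires. *)
have -> : coord_proj e f E x = 0 + \sum_(n <- E) of_real R s (mu n / t) *: v n.
  rewrite add0r; apply: eq_bigr => n _; rewrite /v scalerA mulrA -rmorphM /=.
  by rewrite divfK ?gt_eqF// scalar_sign_abs.
apply: rnorm_convex_signs => [|d|n nE]; first exact: fset_uniq; last first.
  by rewrite ger0_norm ?divr_ge0 ?scalar_abs_ge0 ?(ltW t0)// ler_pdivrMr// mul1r htE.
have -> : \sum_(n <- E) of_real R s ((-1) ^+ d n) *: v n =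
    of_real R s t *: indicator_sum e
      (fun n => of_real R s ((-1) ^+ d n) * scalar_sign (f n x)) E.
  rewrite scaler_sumr; apply: eq_bigr => n _; rewrite !scalerA.
  by congr (_ *: _); rewrite mulrCA.
rewrite add0r rnormZr ger0_norm ?(ltW t0)//.
have trunc : rnorm (of_real R s t *:
    indicator_sum e (fun n => scalar_sign (f n y)) D) <= 2 * C * rnorm y.
  apply: quasi_greedy_truncation => // n nD.
  by have := nD; rewrite inE cy => /andP[/negbTE -> _]; exact: hn0.
apply: le_trans (_ : Cd * rnorm (of_real R s t *:
    indicator_sum e (fun n => scalar_sign (f n y)) D) <= _); last by rewrite ler_pM2l.
rewrite rnormZr ger0_norm ?(ltW t0)// mulrCA ler_pM2l//; apply: hCd => //.
- by apply/fdisjointP => n; rewrite !inE => /andP[/negbTE ->]; rewrite andbF.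
- move=> n; rewrite normrM scalar_sign_norm mulr1 normr_of_real normrX normrN1 expr1n.
  exact: rmorph1.
- by move=> n; exact: scalar_sign_norm.
Qed.

End Estimates.

(** * Attainment of the least constants *)

Section LeastConstants.
Local Set Implicit Arguments.
Local Unset Strict Implicit.
Variables (R : realType) (s : scalars) (X : completeNormedModType (scalar_field R s)).
Local Notation K := (scalar_field R s).
Variables (e : nat -> X) (f : nat -> {scalar X}) (w : nat -> R).
Hypotheses (hB : is_basis e f) (hw : forall i, 0 < w i).

(** Supplies the positive left side asked for by [least_element_exists]: one greedy step cannot
    remove both nonzero coefficients. *)
Lemma greedy_remainder_gt0 :
  0 < rnorm (e 0%N + e 1%N - greedy_sum e f 1 (e 0%N + e 1%N)).
Proof.
set x := e 0%N + e 1%N.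
rewrite lt_neqAle rnorm_ge0 andbT eq_sym rnorm_eq0 subr_eq0; apply/eqP => xG.
have fx (k : nat) : (k < 2)%N -> f k x != 0.
  rewrite linearD /= !(basis_biorthogonal hB).
  by case: k => [|[|]]// _; rewrite ?addr0 ?add0r oner_eq0.
have mem (k : nat) : (k < 2)%N -> k = greedy_next f x fset0.
  move=> k2; apply/eqP; have := congr1 (f k) xG.
  rewrite (coef_coord_proj hB) /= !inE orbF; case: ifP => // _ fx0.
  by have := fx k k2; rewrite fx0 eqxx.
by have := mem 0%N isT; rewrite -(mem 1%N isT).
Qed.

Lemma quasi_greedy_least : quasi_greedy_constants e f !=set0 ->
  exists c, least_element (quasi_greedy_constants e f) c.
Proof.
apply: (@least_element_exists R (X * nat)%type (fun i => (0 < i.2)%N)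
  (fun i => rnorm (i.1 - greedy_sum e f i.2 i.1)) (fun i => rnorm i.1)).
- move=> C; split=> -[C0 hC]; split=> //; first by case=> x m; exact: hC.
  by move=> x m; exact: (hC (x, m)).
- by move=> i _; exact: rnorm_ge0.
- by exists (e 0%N + e 1%N, 1%N); split=> //; exact: greedy_remainder_gt0.
Qed.

Lemma almost_greedy_least : almost_greedy_constants e f w !=set0 ->
  exists c, least_element (almost_greedy_constants e f w) c.
Proof.
apply: (@least_element_exists R (X * nat)%type (fun i => (0 < i.2)%N)
  (fun i => rnorm (i.1 - greedy_sum e f i.2 i.1))
  (fun i => best_weighted_error e f w (weight w (greedy_set f i.1 i.2)) i.1)).
- move=> C; split=> -[C0 hC]; split=> //; first by case=> x m; exact: hC.
  by move=> x m; exact: (hC (x, m)).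
- move=> i _; apply: best_weighted_error_ge => [|E _]; first exact: weight_ge0.
  exact: rnorm_ge0.
- by exists (e 0%N + e 1%N, 1%N); split=> //; exact: greedy_remainder_gt0.
Qed.

(** The relation [P] covers both forms of democracy; a nonempty [A] gives a nonzero indicator
    sum. *)
Lemma democratic_least (P : {fset nat} -> {fset nat} -> Prop) (S : set R) :
  (forall C, S C <-> 0 < C /\ forall (A B : {fset nat}) (eps eps' : nat -> K),
     P A B -> is_sign eps -> is_sign eps' ->
     rnorm (indicator_sum e eps A) <= C * rnorm (indicator_sum e eps' B)) ->
  (exists A B : {fset nat}, P A B /\ A != fset0) ->
  S !=set0 -> exists c, least_element S c.
Proof.
move=> SE [A [B [AB /fset0Pn[k kA]]]].
apply: (@least_element_exists R
  ({fset nat} * {fset nat} * ((nat -> K) * (nat -> K)))%type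
  (fun i => [/\ P i.1.1 i.1.2, is_sign i.2.1 & is_sign i.2.2])
  (fun i => rnorm (indicator_sum e i.2.1 i.1.1))
  (fun i => rnorm (indicator_sum e i.2.2 i.1.2))).
- move=> C; apply: iff_trans (SE C) _; split=> -[C0 hC]; split=> //.
    by move=> [[A' B'] [eps eps']] [/= PAB h h']; exact: hC.
  by move=> A' B' eps eps' PAB h h'; exact: (hC ((A', B'), (eps, eps'))).
- by move=> i _; exact: rnorm_ge0.
have one_sign : is_sign (fun=> 1 : K) by move=> n; exact: normr1.
exists ((A, B), (fun=> 1, fun=> 1)); split=> //=.
rewrite lt_neqAle rnorm_ge0 andbT eq_sym rnorm_eq0; apply/eqP => A0.
have := coef_indicator_sum hB (fun=> 1) A k.
by rewrite A0 linear0 kA => /esym/eqP; rewrite oner_eq0.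
Qed.

Lemma super_democratic_least : super_democratic_constants e w !=set0 ->
  exists c, least_element (super_democratic_constants e w) c.
Proof.
apply: (@democratic_least (fun A B => weight w A <= weight w B)) => //.
exists [fset 0%N]%fset, [fset 0%N]%fset; split=> //.
by apply/fset0Pn; exists 0%N; rewrite inE.
Qed.

Lemma disjoint_super_democratic_least :
  disjoint_super_democratic_constants e w !=set0 ->
  exists c, least_element (disjoint_super_democratic_constants e w) c.
Proof.
apply: (@democratic_least
  (fun A B => weight w A <= weight w B /\ [disjoint A & B]%fset)).
  move=> C; split=> -[C0 hC]; split=> // A B eps eps'.
    by move=> [AB disj]; exact: hC.
  by move=> AB disj; apply: hC.
have ne (i : nat) : [fset i]%fset != fset0 by apply/fset0Pn; exists i; rewrite inE.
have disj (i j : nat) : i != j -> [disjoint [fset i] & [fset j]]%fset.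
  by move=> ij; apply/fdisjointP => n; rewrite !inE => /eqP ->.
(* The lighter of two singletons takes the role of [A]. *)
have [h|/ltW h] := leP (weight w [fset 0%N]%fset) (weight w [fset 1%N]%fset).
  by exists [fset 0%N]%fset, [fset 1%N]%fset; split=> //; split=> //; exact: disj.
by exists [fset 1%N]%fset, [fset 0%N]%fset; split=> //; split=> //; exact: disj.
Qed.

End LeastConstants.

Theorem theorem1p5 (R : realType) (s : scalars)
    (X : completeNormedModType (scalar_field R s))
    (e : nat -> X) (f : nat -> {scalar X}) (w : nat -> R)
    (hw : forall i, 0 < w i) (hB : is_basis e f) :
  (forall Ca : R, least_element (almost_greedy_constants e f w) Ca ->
     exists Cq Csd Cs : R,
       [/\ least_element (quasi_greedy_constants e f) Cq,
           least_element (disjoint_super_democratic_constants e w) Csd,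
           least_element (super_democratic_constants e w) Cs,
           Num.max Cq Csd <= Ca
         & Cs <= 2 * kappa R s * Ca])
  /\
  (forall Cq Csd : R,
     least_element (quasi_greedy_constants e f) Cq ->
     least_element (disjoint_super_democratic_constants e w) Csd ->
     exists Ca : R,
       least_element (almost_greedy_constants e f w) Ca /\
       Ca <= Cq + 2 * Cq * Csd).
Proof.
split=> [Ca [hCa _]|Cq Csd [hCq _] [hCsd _]].
  have hq := almost_greedy_quasi_greedy hw hCa.
  have hsd := almost_greedy_disjoint_super_democratic hB hw hCa.
  have hs := almost_greedy_super_democratic hB hw hCa.
  have [Cq lq] := quasi_greedy_least hB (ex_intro _ _ hq).
  have [Csd lsd] := disjoint_super_democratic_least hB (ex_intro _ _ hsd).
  have [Cs ls] := super_democratic_least hB (ex_intro _ _ hs).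
  exists Cq, Csd, Cs; split=> //; last exact: ls.2.
  by rewrite ge_max lq.2// lsd.2.
have Cq0 : 0 < Cq by case: hCq.
have Csd0 : 0 < Csd by case: hCsd.
have h : almost_greedy_constants e f w (Cq + 2 * Cq * Csd).
  have C0 : 0 < Cq + 2 * Cq * Csd by rewrite addr_gt0// !mulr_gt0.
  (* Dividing by the constant turns the claim into a lower bound of the infimum, to be checked for
     each competitor [E]. *)
  split=> // x m _; rewrite mulrC -ler_pdivrMr//.
  apply: best_weighted_error_ge => [|E hE]; first exact: weight_ge0.
  rewrite ler_pdivrMr// mulrC; apply: quasi_greedy_democratic_almost_greedy => //.
  exact: (greedy_set_weakly_greedy hB).
have [Ca lCa] := almost_greedy_least hB hw (ex_intro _ _ h).
by exists Ca; split=> //; exact: (lCa.2 _ h).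
Qed.
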